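(* Let $p,q\in\mathbb N$. There exists a Cantor set $Z$ and a continuous surjection $g\colon Z\to Z$ such that the set of fundamental periods of periodic points of the induced map $2^g$ is exactly $$\mathrm{Per}(2^g)=\{m\in\mathbb N: m\mid p\ \text{or}\ m\mid q\}.$$
   Context: $2^Z$ is the space of nonempty closed subsets of $Z$ with the Hausdorff metric, and $2^g(C)=g(C)$. $\mathrm{Per}(2^g)$ is the set of all $k\in\mathbb N$ such that some $C\in 2^Z$ has fundamental (least) period $k$ under $2^g$. *)

(* Defs.v *)
From HB Require Import structures.
From mathcomp Require Import all_boot all_order all_algebra.
From mathcomp Require Import all_classical all_reals all_analysis.
Set Implicit Arguments. Unset Strict Implicit. Unset Printing Implicit Defensive.
Local Open Scope classical_set_scope.

Definition hyper_elem {Z : topologicalType} (C : set Z) : Prop :=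
  C !=set0 /\ closed C.

Definition hyper_map {Z : Type} (g : Z -> Z) (C : set Z) : set Z := g @` C.
Definition hyper_iter {Z : Type} (g : Z -> Z) (k : nat) (C : set Z) : set Z :=
  iter k (hyper_map g) C.

Definition fund_period {Z : Type} (g : Z -> Z) (C : set Z) (k : nat) : Prop :=
  (0 < k)%N /\ hyper_iter g k C = C /\
  (forall j : nat, (0 < j)%N -> (j < k)%N -> hyper_iter g j C <> C).

Definition Per_hyper {Z : topologicalType} (g : Z -> Z) : set nat :=
  [set k | exists C : set Z, hyper_elem C /\ fund_period g C k].

(* Main.v *)
Require Import Defs.
From HB Require Import structures.
From mathcomp Require Import all_boot all_order all_algebra.
From mathcomp Require Import all_classical all_reals all_analysis.
From mathcomp Require Import Rstruct zify.
From Stdlib Require Rdefinitions.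
Set Implicit Arguments. Unset Strict Implicit. Unset Printing Implicit Defensive.
Import Order.TTheory GRing.Theory Num.Theory.
Local Open Scope classical_set_scope.
Local Open Scope ring_scope.

(** The map is a two-sided subshift.  Put markers on the integers at the finite
    subset sums of a fast growing sequence [jump n] that is eventually congruent
    to 1 modulo every K, and let [word] display the position modulo q at a marker
    and the distance to the next marker modulo p elsewhere.  The orbit closure of
    [word] contains one p-cycle, made of the points without marker; the other
    points split into q phase classes permuted cyclically by the shift.  Each
    block of the marker pattern recurs along any point with a marker at gaps
    covering all residues modulo K.  So, when q divides K, the orbit of such a
    point under the K-th power of the shift is dense in its phase class together
    with the p-cycle.  Hence a closed set fixed by some power of the shift either
    lies in the p-cycle, or is the p-cycle together with a union of phase classes;
    its period divides p in the first case and q in the second. *)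

(** * The marker pattern *)

(** [block_end n] is the sum of [jump i] over [i < n], the largest marker of level [n]. The
    increment is written out because [jump] is itself defined from [block_end]. *)
Fixpoint block_end (n : nat) : nat :=
  if n is n'.+1 then (block_end n' + (n'`! * (block_end n' + n')).+1)%N else 0%N.

(** The factorial makes this 1 modulo every positive [K <= n]; the other factor leaves a gap of more
    than [n] after a block. *)
Definition jump (n : nat) : nat := (n`! * (block_end n + n)).+1.

Lemma block_endS n : block_end n.+1 = (block_end n + jump n)%N. Proof. by []. Qed.

Lemma jump_gap n : (block_end n + n < jump n)%N.
Proof. by rewrite ltnS leq_pmull ?fact_gt0. Qed.

Lemma jump_mod K n : (0 < K)%N -> (K <= n)%N -> (K %| (jump n)%:Z - 1)%Z.
Proof.
move=> K0 Kn; have -> : (jump n)%:Z - 1 = (n`! * (block_end n + n))%N%:Z by rewrite /jump; lia.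
by rewrite PoszM dvdz_mulr // dvdzE /= dvdn_fact ?K0.
Qed.

Lemma block_end_ge n : (n <= block_end n)%N.
Proof. by elim: n => // n IH; rewrite block_endS; have := jump_gap n; lia. Qed.

Lemma block_end_le m n : (m <= n)%N -> (block_end m <= block_end n)%N.
Proof. by move=> /subnK <-; elim: (n - m)%N => // k IH; rewrite addSn block_endS (leq_trans IH) ?leq_addr. Qed.

(* [dist_upto n i] is the distance from [i] to the next marker, meaningful only for
   [i <= block_end n]; the markers up to [block_end n.+1] are those up to [block_end n]
   and their translates by [jump n]. *)
Fixpoint dist_upto (n : nat) (i : int) : nat :=
  if n is n'.+1 then
    if i <= (block_end n')%:Z then dist_upto n' i else dist_upto n' (i - (jump n')%:Z)
  else `|i|%N.

(** Level [|i|] is high enough because [n <= block_end n]. *)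
Definition dist_next (i : int) : nat := dist_upto `|i|%N i.

Lemma dist_upto_widen m n i : (m <= n)%N -> i <= (block_end m)%:Z ->
  dist_upto n i = dist_upto m i.
Proof.
elim: n => [|n IH]; first by rewrite leqn0 => /eqP ->.
rewrite leq_eqVlt => /predU1P[-> //|mn] im /=.
have := block_end_le (mn : (m <= n)%N) => smn.
by rewrite ifT ?IH //; lia.
Qed.

Lemma dist_nextE n i : i <= (block_end n)%:Z -> dist_next i = dist_upto n i.
Proof.
move=> ni; rewrite /dist_next; have := block_end_ge `|i|%N => si.
have [mn|/ltnW mn] := leqP n `|i|%N; first by rewrite (dist_upto_widen mn).
by rewrite (dist_upto_widen mn) //; lia.
Qed.

Lemma dist_next_le0 i : i <= 0 -> dist_next i = `|i|%N.
Proof. by move=> i0; rewrite (@dist_nextE 0). Qed.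

Lemma dist_next_jump n i : (block_end n)%:Z < (jump n)%:Z + i -> i <= (block_end n)%:Z ->
  dist_next ((jump n)%:Z + i) = dist_next i.
Proof.
move=> ni iN; rewrite (@dist_nextE n.+1) ?block_endS ?(@dist_nextE n i) //=; last by lia.
by rewrite leNgt ni /= [_ + i]addrC addrK.
Qed.

Lemma dist_next_block_end n : dist_next (block_end n)%:Z = 0%N.
Proof.
elim: n => // n IH; rewrite block_endS PoszD addrC dist_next_jump //.
by have := jump_gap n; lia.
Qed.

Lemma dist_next_pred i : dist_next i <> 0%N -> dist_next i = (dist_next (i + 1)).+1.
Proof.
have [n] : exists n, i + 1 <= (block_end n)%:Z.
  by exists (absz (i + 1)); have := block_end_ge (absz (i + 1)); lia.
elim: n i => [|n IH] i; first by move=> /= i0; rewrite !dist_next_le0; lia.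
have [/IH //|ni] := leP (i + 1) (block_end n)%:Z.
rewrite block_endS => iN.
have [->|ine] := eqVneq i (block_end n)%:Z; first by rewrite dist_next_block_end.
have [i' iE] : exists i' : int, i = (jump n)%:Z + i' by exists (i - (jump n)%:Z); lia.
have g := jump_gap n; rewrite iE -addrA !dist_next_jump; try lia.
by apply: IH; lia.
Qed.

(** * Copies of a block, with a left margin, inside larger blocks *)

Definition replica (n m : nat) (f : int) : Prop :=
  forall i : int, - m%:Z <= i <= (block_end n)%:Z -> dist_next (f + i) = dist_next i.

Lemma replica0 n m : replica n m 0.
Proof. by move=> i _; rewrite add0r. Qed.

Lemma replica_pred n m f : replica n.+1 m f -> replica n m f.
Proof. by move=> c i Hi; apply: c; rewrite block_endS; lia. Qed.

(** The upper half of a block is a copy of the lower half; its left margin [m <= n] fits into the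
    gap between the halves. *)
Lemma replica_jump n m f : (m <= n)%N -> replica n.+1 m f ->
  replica n m (f + (jump n)%:Z).
Proof.
move=> mn c i Hi; have := jump_gap n => g.
by rewrite -addrA c ?block_endS ?dist_next_jump //; lia.
Qed.

Lemma replica_around n m t f b : (m <= n)%N -> replica (n + t) m f ->
  f <= b <= f + (block_end (n + t))%:Z -> dist_next b = 0%N ->
  exists2 f', replica n m f' & f' <= b <= f' + (block_end n)%:Z.
Proof.
move=> mn; elim: t f => [|t IH] f; rewrite ?addn0; first by exists f.
rewrite addnS => c Hb b0.
have g := jump_gap (n + t).
have [i bE] : exists i : int, b = f + i by exists (b - f); rewrite addrC subrK.
have i0 : dist_next i = 0%N by rewrite -(c i) -?bE //; lia.
have [it|ti] := leP i (block_end (n + t))%:Z.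
  by apply: (IH f) => //; [exact: replica_pred|lia].
have [ji|ij] := leP (jump (n + t))%:Z i.
  apply: (IH (f + (jump (n + t))%:Z)) => //.
    by apply: replica_jump => //; exact: leq_trans (leq_addr _ _).
  by move: Hb; rewrite block_endS; lia.
(* Between the two halves the distance to the next marker is [|j|] with [j < 0], so no marker lies
   there. *)
have [j iE] : exists j : int, i = (jump (n + t))%:Z + j by exists (i - (jump (n + t))%:Z); lia.
by move: i0; rewrite iE dist_next_jump ?dist_next_le0; lia.
Qed.

(* Each level offers a translation by [jump _], which is 1 modulo [K], or none:
   [c] translations realise the residue [c]. *)
Lemma replica_residue n m K t c f : (0 < K)%N -> (K <= n)%N -> (m <= n)%N ->
  replica (n + t) m f -> (c <= t)%N ->
  exists e : nat, [/\ (c <= e)%N, (e <= block_end (n + t))%N, (K %| e%:Z - c%:Z)%Z &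
    replica n m (f + e%:Z)].
Proof.
move=> K0 Kn mn; elim: t c f => [|t IH] c f.
  by rewrite addn0 leqn0 => cf /eqP ->; exists 0%N; rewrite subrr dvdz0 addr0.
rewrite addnS leq_eqVlt => cf /predU1P[->|].
  have [||e [te es Ke ce]] := IH t (f + (jump (n + t))%:Z) => //.
    by apply: replica_jump => //; exact: leq_trans (leq_addr _ _).
  exists (e + jump (n + t))%N; split; last by rewrite PoszD addrA addrAC.
  - by rewrite /jump; lia.
  - by rewrite block_endS; lia.
  - rewrite (_ : _ - _ = (e%:Z - t%:Z) + ((jump (n + t))%:Z - 1)); last by lia.
    by rewrite rpredD // jump_mod // (leq_trans Kn) // leq_addr.
rewrite ltnS => ct; have [||e [te es Ke ce]] := IH c f => //.
  exact: replica_pred.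
by exists e; split=> //; rewrite block_endS; lia.
Qed.

(** * The subshift *)

Section subshift.
Variables p q : nat.
Hypotheses (p_gt0 : (0 < p)%N) (q_gt0 : (0 < q)%N).

(* Symbols below [p] count down to the next marker, symbols [p + j] with [j < q] are
   markers. *)
Definition word (i : int) : nat :=
  if dist_next i == 0%N then (p + absz (i %% q%:Z)%Z)%N else (dist_next i %% p)%N.

(** The closure of the shift orbit of [word], expressed through central windows. *)
Definition subshift : set (int -> nat) :=
  [set w | forall m : nat, exists r : int,
    forall n : int, (`|n| <= m)%N -> w n = word (n + r)].

Lemma word_lt i : (word i < p + q)%N.
Proof.
rewrite /word; case: ifP => _; last by rewrite ltn_addr // ltn_mod.
have : (i %% q%:Z)%Z < q%:Z by rewrite ltz_mod //; lia.
have : 0 <= (i %% q%:Z)%Z by rewrite modz_ge0 //; lia.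
lia.
Qed.

Lemma word_marker i : (p <= word i)%N = (dist_next i == 0%N).
Proof.
rewrite /word; case: ifP => _; first by rewrite leq_addr.
by rewrite leqNgt ltn_mod p_gt0.
Qed.

Lemma word_phase i : (p <= word i)%N -> (q%:Z %| (word i)%:Z - p%:Z - i)%Z.
Proof.
rewrite word_marker /word => ->; rewrite PoszD.
have := divz_eq i q%:Z; have : 0 <= (i %% q%:Z)%Z by rewrite modz_ge0 //; lia.
case: (i %% q%:Z)%Z => // r _ iE; apply/dvdzP; exists (- (i %/ q%:Z)%Z).
rewrite {1}iE /=; lia.
Qed.

Lemma word_countdown i : (word i < p)%N -> (word (i + 1) < p)%N ->
  (p%:Z %| (word i)%:Z - (word (i + 1))%:Z - 1)%Z.
Proof.
clear q_gt0.
rewrite !ltnNge !word_marker /word => i0 j0; rewrite (negbTE i0) (negbTE j0).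
rewrite dist_next_pred; last exact/eqP.
set k := dist_next (i + 1).
rewrite (_ : _ - _ = (k.+1 %% p)%:Z - k.+1%:Z - ((k %% p)%:Z - k%:Z)); last by lia.
by rewrite rpredB // -eqz_mod_dvd -!modz_nat modz_mod.
Qed.

Lemma subshift_lt w n : subshift w -> (w n < p + q)%N.
Proof. by move=> /(_ (absz n))[r ->] //; exact: word_lt. Qed.

(** One window of [word] contains both markers, and there symbol minus position is constant modulo
    [q]. This residue is the phase of [w]. *)
Lemma subshift_phase w n n' : subshift w -> (p <= w n)%N -> (p <= w n')%N ->
  (q%:Z %| ((w n)%:Z - n) - ((w n')%:Z - n'))%Z.
Proof.
move=> /(_ (absz n + absz n')%N)[r wE].
rewrite !wE ?leq_addr ?leq_addl // => /word_phase h /word_phase h'.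
move: (rpredB h h'); congr (_ %| _)%Z; lia.
Qed.

Lemma subshift_countdown w n : subshift w -> (w n < p)%N -> (w (n + 1)%R < p)%N ->
  (p%:Z %| (w n)%:Z - (w (n + 1))%:Z - 1)%Z.
Proof.
clear q_gt0.
move=> /(_ (absz n + 1)%N)[r wE]; rewrite !wE ?leq_addr //; last by lia.
rewrite addrAC; exact: word_countdown.
Qed.

(** Without markers the symbols drop by 1 modulo [p] at each step; being below [p], they are equal
    once congruent. *)
Lemma word_periodic w : subshift w -> (forall n, w n < p)%N -> forall n, w (n + p%:Z) = w n.
Proof.
clear q_gt0.
move=> wZ wp n.
have H k : (p%:Z %| (w n)%:Z - (w (n + k%:Z))%:Z - k%:Z)%Z.
  elim: k => [|k IH]; first by rewrite addr0 subr0 subrr dvdz0.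
  rewrite (_ : n + k.+1%:Z = n + k%:Z + 1); last by lia.
  have := rpredD IH (subshift_countdown wZ (wp (n + k%:Z)) (wp _)).
  congr (_ %| _)%Z; lia.
have : (p%:Z %| (w n)%:Z - (w (n + p%:Z))%:Z)%Z.
  by rewrite -[X in (_ %| X)%Z](subrK p%:Z) rpredD // dvdzz.
rewrite -eqz_mod_dvd !modz_nat !modn_small // => /eqP[->//].
Qed.

Lemma subshift_word r : subshift (fun n => word (n + r)).
Proof. by move=> m; exists r. Qed.

Lemma subshift_shift w r : subshift w -> subshift (fun n => w (n + r)).
Proof.
clear p_gt0 q_gt0.
move=> wZ m; have [s wE] := wZ (m + absz r)%N.
by exists (r + s) => n nm; rewrite wE ?addrA //; lia.
Qed.

(* Far to the left of 0, [word] has no marker and is p-periodic. *)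
Lemma subshift_cycle : subshift (fun n => absz (- n %% p%:Z)%Z).
Proof.
clear q_gt0.
(* A multiple of [p] preserves the countdown, and at least [m.+1] puts the whole window left of
   0. *)
move=> m; exists (- (p * m.+1)%N%:Z) => n nm.
have mp : (m.+1 <= p * m.+1)%N by rewrite leq_pmull.
rewrite /word dist_next_le0; last by lia.
rewrite ifF; last by lia.
apply/eqP; rewrite -eqz_nat -modz_nat.
rewrite (_ : `|_|%N%:Z = (- n %% p)%Z); last by rewrite gez0_abs ?modz_ge0 //; lia.
rewrite (_ : `|_|%N%:Z = - n + m.+1%:Z * p%:Z); last by lia.
by rewrite [- n + _]addrC modzMDl.
Qed.

Lemma subshift_recurrent r m : exists2 e : nat, (0 < e)%N &
  forall n : int, (`|n| <= m)%N -> word (n + (e%:Z + r)) = word (n + r).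
Proof.
clear p_gt0.
pose m' := (m + absz r + q)%N.
(* The residue 0 is requested as [q], so that the bound [q <= e] makes [e] positive. *)
have [|||e [qe _ /dvdzP[c cE] ce]] := @replica_residue m' m' q q q 0 q_gt0 _ _ (@replica0 _ _) => //.
  by rewrite leq_addl.
exists e; first exact: leq_trans qe.
move=> n nm; have sm := block_end_ge m'; have m'E : m' = (m + absz r + q)%N by [].
clearbody m'.
have /= := ce (n + r); rewrite add0r => E.
have {}E : dist_next (n + (e%:Z + r)) = dist_next (n + r).
  by rewrite addrCA E //; lia.
rewrite /word E; case: ifP => // _.
rewrite addrCA (_ : e%:Z = (c + 1) * q%:Z); last by lia.
by rewrite modzMDl.
Qed.

(** A large block around the marker [a] of [w] contains copies of the block showing the window of
    [y], at offsets in every class modulo [K]. The phase hypothesis then matches the marker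
    symbols. *)
Lemma subshift_dense w y a K m : subshift w -> subshift y -> (p <= w a)%N ->
  (0 < K)%N -> (q %| K)%N ->
  (forall n, (p <= y n)%N -> (q%:Z %| ((y n)%:Z - n) - ((w a)%:Z - a))%Z) ->
  exists j : int, forall n : int, (`|n| <= m)%N -> y n = w (n + K%:Z * j).
Proof.
move=> wZ yZ wa K0 qK yw.
have [r yE] := yZ m.
(* Level [m'] covers the window of [y] and has jumps congruent to 1 modulo [K]; [K] further levels
   supply all residues. *)
pose m' := (m + absz r + K)%N; pose s := block_end (m' + K).
have [b0 wE] := wZ (m + absz r + absz a + s)%N.
have wab : w a = word (a + b0) by rewrite wE //; lia.
have ab0 : dist_next (a + b0) = 0%N by apply/eqP; rewrite -word_marker -wab.
have [f cf fb] : exists2 f, replica (m' + K) m' f & f <= a + b0 <= f + s%:Z.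
  pose t := absz (a + b0).
  apply: (@replica_around _ m' t 0) => //; first by lia.
    exact: replica0.
  have := block_end_ge (m' + K + t); have [/dist_next_le0|] := leP (a + b0) 0; lia.
(* This residue makes the total displacement [f + e + r - b0] a multiple of [K]. *)
have [c cK [k cE]] : exists2 c : nat, (c <= K)%N & exists k : int, c%:Z = b0 - f - r + k * K%:Z.
  have := divz_eq (b0 - f - r) K%:Z; set u := b0 - f - r.
  have : (u %% K%:Z)%Z < K%:Z by rewrite ltz_mod //; lia.
  have : 0 <= (u %% K%:Z)%Z by rewrite modz_ge0 //; lia.
  case: (u %% _)%Z => // c _ cK E; exists c; first by lia.
  by exists (- (u %/ K%:Z)%Z); lia.
have [||e [_ es /dvdzP[k' eE] ce]] := @replica_residue m' m' K K c f K0 _ _ cf cK => //.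
  by rewrite leq_addl.
exists (k + k') => n nm; rewrite yE //.
have jE : K%:Z * (k + k') + b0 = f + e%:Z + r by lia.
rewrite wE; last by move: es fb; rewrite -/s; lia.
rewrite -addrA jE.
have sm := block_end_ge m'; have m'E : m' = (m + absz r + K)%N by [].
have E : dist_next (n + (f + e%:Z + r)) = dist_next (n + r).
  by rewrite addrCA ce //; clearbody m'; lia.
(* The distances agree, so countdown symbols do too; at a marker the positions must still be
   compared modulo [q]. *)
rewrite /word E; case: ifP => // /eqP d0; congr (_ + `|_|)%N.
have yn : (p <= y n)%N by rewrite yE // word_marker d0.
have := yw _ yn; rewrite wab yE //.
have /word_phase h : (p <= word (n + r))%N by rewrite -yE.
have /word_phase h' : (p <= word (a + b0))%N by rewrite -wab.
move=> h''; apply/eqP; rewrite eq_sym eqz_mod_dvd.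
have qKz : (q%:Z %| K%:Z)%Z by [].
have h3 := dvdz_mulr (k + k') qKz.
have := rpredD (rpredB (rpredB h h') h'') h3.
congr (_ %| _)%Z.
lia.
Qed.

End subshift.

(** * Topology of the shift space *)

Lemma nbhs_windowP (x : {ptws int -> nat}) (U : set {ptws int -> nat}) :
  nbhs x U <-> exists m : nat, forall y : {ptws int -> nat},
    (forall n : int, (`|n| <= m)%N -> y n = x n) -> U y.
Proof.
pose W (m : nat) := [set y : {ptws int -> nat} | forall n : int, (`|n| <= m)%N -> y n = x n].
split=> [xU|[m mU]].
  pose F := filter_from [set: nat] W.
  have FF : Filter F.
    apply: filter_from_filter; first by exists 0%N.
    move=> i j _ _; exists (maxn i j) => // y Wy.
    by split=> n ni; apply: Wy; rewrite (leq_trans ni) ?leq_maxl ?leq_maxr.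
  (* Convergence is checked one coordinate at a time, and coordinate [t] is fixed by the window of
     radius [|t|]. *)
  suff : {ptws, F --> x} by move=> /(_ U xU)[m _ mU]; exists m.
  apply/cvg_sup => t V [B [[C oC <-] xC CV]].
  by exists (absz t) => // y yt; apply: CV; rewrite /= yt.
apply: (@filterS _ _ _ (W m)) => //.
have one (n : int) : nbhs x [set y : {ptws int -> nat} | y n = x n].
  have := @proj_continuous int (fun=> nat) n x [set x n].
  by apply; apply: open_nbhs_nbhs; split=> //; exact: discrete_open.
clear mU; elim: m => [|m IH].
  by apply: filterS (one 0) => y y0 n; rewrite leqn0 absz_eq0 => /eqP ->.
apply: filterS (filterI IH (filterI (one m.+1%:Z) (one (- m.+1%:Z)%R))).
move=> y [yW [/= yp yn]] n; rewrite leq_eqVlt => /predU1P[|]; last exact: yW.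
by case: (intP n) => [//|k|k]; rewrite ?abszN /= => -[->].
Qed.

Lemma closed_windowP (A : set {ptws int -> nat}) :
  closed A <-> forall x, (forall m : nat, exists2 y, A y &
    forall n : int, (`|n| <= m)%N -> x n = y n) -> A x.
Proof.
split=> [cA x xA|cA x xA].
  apply: cA => U /nbhs_windowP[m mU]; have [y Ay xy] := xA m.
  by exists y; split=> //; apply: mU => n /xy.
apply: cA => m; have [|y [Ay xy]] := xA [set y | forall n : int, (`|n| <= m)%N -> x n = y n].
  by apply/nbhs_windowP; exists m => y xy n /xy.
by exists y.
Qed.

(** The subtype of [Z], pointed by [x0], inherits all conditions of [cantor_like]; [h] is the
    resulting homeomorphism followed by the inclusion. *)
Lemma cantor_embedding (R : realType) (T : pseudoMetricType R) (Z : set T) :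
  hausdorff_space T -> zero_dimensional T -> compact Z -> Z !=set0 ->
  (forall x U, Z x -> nbhs x U -> exists y, [/\ Z y, U y & y <> x]) ->
  exists h : cantor_space -> T, [/\ continuous h, injective h & range h = Z].
Proof.
move=> hT zT cZ [x0 Zx0] perfZ.
pose isP := @isPointed.Build (set_type Z) (exist _ x0 (mem_set Zx0)).
pose P : pseudoPMetricType R := HB.pack (set_type Z) isP.
have valc : continuous (set_val : P -> T) by exact: initial_continuous.
have cP : cantor_like P.
  split.
  - apply/perfectTP => z [V oV Vz].
    have Vvz : V (set_val z) by rewrite -[V _]/((set_val @^-1` V) z) Vz.
    have [||y [Zy Vy yz]] := perfZ (set_val z) V.
    + exact: set_valP.
    + exact: open_nbhs_nbhs.
    + apply: yz; have : (set_val @^-1` V) (exist _ y (mem_set Zy)) by [].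
      by rewrite Vz => <-.
  - move=> F FF _; have [|a [Za Fa]] := cZ (set_val @ F).
    + by apply: (@filterS _ F _ setT) => [y _|]; [exact: set_valP|exact: filterT].
    + exists (exist _ a (mem_set Za)); split=> // U B FU [V [[W oW WV] Va VB]].
      have [||_ [[y Uy <-] Wy]] := Fa (set_val @` U) W.
      * by apply: (@filterS _ F _ U) => // y Uy; exists y.
      * by apply: open_nbhs_nbhs; split=> //; move: Va; rewrite -WV.
      * by exists y; split=> //; apply: VB; rewrite -WV.
  - move=> x y xy; apply: val_inj; apply: hT => U V xU yV.
    by have [z [zU zV]] := xy _ _ (valc _ _ xU) (valc _ _ yV); exists (set_val z).
  - move=> x y xy; have [|U [cU Ux Uy]] := zT (set_val x) (set_val y).
      by apply: contra_neq xy; exact: val_inj.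
    exists (set_val @^-1` U); split=> //.
    exact: preimage_clopen.
have [f [cf _]] := homeomorphism_cantor_like cP.
exists (set_val \o f); split.
- by move=> x; apply: continuous_comp; [exact: cf|exact: valc].
- by move=> x y /val_inj; exact: (in2TT 'inj_f).
- apply/seteqP; split=> [_ [x _ <-]|x Zx]; first exact: set_valP.
  have [y _ fy] : range f (exist _ x (mem_set Zx) : P) by exact: 'surj_f.
  by exists y => //=; rewrite fy.
Qed.

(** * Induced maps on sets: iterates, periods and conjugacy *)

Lemma image_iter_preimage (Z : Type) (S S' : Z -> Z) k (C : set Z) :
  cancel S S' -> cancel S' S -> hyper_iter S k C = iter k S' @^-1` C.
Proof.
move=> SK S'K; rewrite /hyper_iter; elim: k => [|k IH]; first by rewrite preimage_id.
rewrite iterS IH /hyper_map; apply/seteqP; split=> x.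
  by move=> [y Cy <-]; rewrite /preimage /= -iterS iterSr SK.
by move=> Cx; exists (S' x); rewrite ?S'K // /preimage /= -iterSr.
Qed.

Lemma fund_period_dvd (Z : Type) (g : Z -> Z) (C : set Z) k n :
  fund_period g C k -> hyper_iter g n C = C -> (k %| n)%N.
Proof.
move=> [k0 [gk kmin]] gn.
have gkM j : hyper_iter g (j * k) C = C.
  by elim: j => // j IH; rewrite mulSn /hyper_iter iterD -/(hyper_iter g (j * k) C) IH.
have gr : hyper_iter g (n %% k) C = C.
  rewrite -[in RHS]gn {2}(divn_eq n k) addnC /hyper_iter iterD.
  by rewrite -/(hyper_iter g (n %/ k * k) C) gkM.
have [/eqP//|r0] := posnP (n %% k)%N.
by case: (kmin _ r0 (ltn_pmod n k0)).
Qed.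

Lemma fund_period_conj (Y Z : Type) (g : Y -> Y) (S : Z -> Z) (h : Y -> Z) (C : set Y) k :
  injective h -> (forall y, h (g y) = S (h y)) ->
  fund_period g C k <-> fund_period S (h @` C) k.
Proof.
move=> hI hg.
have iterE j : hyper_iter S j (h @` C) = h @` hyper_iter g j C.
  elim: j => // j IH; rewrite /hyper_iter !iterS -!/(hyper_iter _ j _) IH /hyper_map.
  by rewrite !image_comp; apply: eq_imagel => y _ /=; rewrite hg.
have imI (A B : set Y) : h @` A = h @` B -> A = B.
  by move=> AB; apply/funext => a; rewrite -(image_inj hI) AB image_inj.
rewrite /fund_period iterE; split=> -[k0 [gk kmin]]; split=> //; split.
- by rewrite gk.
- by move=> j j0 jk; rewrite iterE => /imI; exact: kmin.
- exact: imI.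
- by move=> j j0 jk gj; apply: (kmin j j0 jk); rewrite iterE gj.
Qed.

(** Here [g] is [S] pulled back along [h]. Compactness makes [h] a closed map, which gives
    continuity of [g] and carries closed sets in both directions. *)
Lemma cantor_conjugate (T : topologicalType) (h : cantor_space -> T) (S : T -> T) :
  hausdorff_space T -> continuous h -> injective h -> continuous S ->
  S @` range h = range h ->
  exists g : cantor_space -> cantor_space, [/\ continuous g,
    forall y, exists x, g x = y &
    forall k, Per_hyper g k <-> exists D : set T,
      [/\ D `<=` range h, hyper_elem D & fund_period S D k]].
Proof.
move=> hT hc hI Sc Sh.
have gex y : exists x, h x = S (h y).
  have : range h (S (h y)) by rewrite -Sh; exists (h y) => //; exists y.
  by case=> x _ <-; exists x.
have [g hg] := choice gex.
have him (A : set cantor_space) : closed A -> closed (h @` A).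
  move=> cA; apply: compact_closed => //; apply: continuous_compact.
    exact: continuous_subspaceT.
  by apply: subclosed_compact cA cantor_space_compact _.
exists g; split.
- apply/continuous_closedP => A cA.
  have -> : g @^-1` A = h @^-1` (S @^-1` (h @` A)).
    apply/seteqP; split=> x /=; rewrite /preimage /= -hg; first by exists (g x).
    by move=> [a Aa /hI <-].
  apply: (closed_comp (f := h)) => [x _|]; first exact: hc.
  by apply: (closed_comp (f := S)) => [x _|]; [exact: Sc|exact: him].
- move=> y; have : (S @` range h) (h y) by rewrite Sh; exists y.
  by case=> _ [x _ <-] xy; exists x; apply: hI; rewrite hg.
- move=> k; split=> [[C [[C0 cC] gC]]|[D [Dh [D0 cD] SD]]].
    exists (h @` C); split; first exact: image_subset.
      by split; [exact: image_nonempty|exact: him].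
    exact/(fund_period_conj _ _ hI hg).
  have DE : h @` (h @^-1` D) = D.
    apply/seteqP; split; first exact: image_preimage_subset.
    by move=> d Dd; have [y _ yd] := Dh d Dd; exists y => //; rewrite /preimage /= yd.
  exists (h @^-1` D); split; last by apply/(fund_period_conj _ _ hI hg); rewrite DE.
  split; last by apply: closed_comp => // x _; exact: hc.
  by case: D0 => d Dd; have [y _ yd] := Dh _ Dd; exists y; rewrite /preimage /= yd.
Qed.

(** * Periods of closed sets *)

Definition shift_left (w : {ptws int -> nat}) : {ptws int -> nat} := fun n => w (n + 1).

Definition shift_right (w : {ptws int -> nat}) : {ptws int -> nat} := fun n => w (n - 1).

Lemma shift_leftK : cancel shift_left shift_right.
Proof. by move=> w; apply/funext => n; rewrite /shift_left /shift_right subrK. Qed.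

Lemma shift_rightK : cancel shift_right shift_left.
Proof. by move=> w; apply/funext => n; rewrite /shift_left /shift_right addrK. Qed.

Lemma iter_shift_right k w : iter k shift_right w = fun n => w (n - k%:Z).
Proof.
apply/funext => n; elim: k n => [|k IH] n; first by rewrite subr0.
by rewrite iterS /shift_right IH; congr w; lia.
Qed.

Lemma hyper_iter_shift k (D : set {ptws int -> nat}) w :
  hyper_iter shift_left k D w = D (fun n => w (n - k%:Z)).
Proof. by rewrite (image_iter_preimage _ _ shift_leftK shift_rightK) /preimage /= iter_shift_right. Qed.

Lemma hyper_iter_shiftE k (D : set {ptws int -> nat}) :
  hyper_iter shift_left k D = D ->
  forall (j : int) w, D w -> D (fun n => w (n + k%:Z * j)).
Proof.
move=> kD.
have up w : D w -> D (fun n => w (n + k%:Z)).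
  rewrite -{2}kD hyper_iter_shift.
  by rewrite (_ : (fun n => _) = w) //; apply/funext => n; rewrite subrK.
have down w : D w -> D (fun n => w (n - k%:Z)) by rewrite -{1}kD hyper_iter_shift.
have upn (i : nat) w : D w -> D (fun n => w (n + k%:Z * i%:Z)).
  move=> Dw; elim: i => [|i /up].
    by rewrite (_ : (fun n => _) = w) //; apply/funext => n; rewrite mulr0 addr0.
  by congr D; apply/funext => n; congr w; lia.
have downn (i : nat) w : D w -> D (fun n => w (n + k%:Z * - i%:Z)).
  move=> Dw; elim: i => [|i /down].
    by rewrite (_ : (fun n => _) = w) //; apply/funext => n; rewrite oppr0 mulr0 addr0.
  by congr D; apply/funext => n; congr w; lia.
by move=> j w; case: (intP j) => [|i|i] Dw; [exact: (upn 0)|exact: upn|exact: downn].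
Qed.

Lemma shift_continuous : continuous shift_left.
Proof.
move=> w U /nbhs_windowP[m mU]; apply/nbhs_windowP; exists m.+1 => y yw.
by apply: mU => n nm; apply: yw; lia.
Qed.

Section periods.
Variables p q : nat.
Hypotheses (p_gt0 : (0 < p)%N) (q_gt0 : (0 < q)%N).
Let Z : set {ptws int -> nat} := subshift p q.

Lemma subshift_closed : closed Z.
Proof.
apply/closed_windowP => w wZ m; have [y yZ wy] := wZ m; have [r yE] := yZ m.
by exists r => n nm; rewrite wy // yE.
Qed.

Lemma subshift_compact : compact Z.
Proof.
have cP := @tychonoff int (fun=> nat) (fun=> `I_(p + q))
  (fun=> finite_compact (finite_II _)).
apply: subclosed_compact subshift_closed cP _ => w wZ n.
exact: subshift_lt.
Qed.

Lemma subshift_perfect w U : Z w -> nbhs w U -> exists y, [/\ Z y, U y & y <> w].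
Proof.
move=> wZ /nbhs_windowP[m mU]; have [r wE] := wZ m.
have [we|we] := pselect ((fun n => word p q (n + r)) = w); last first.
  by exists (fun n => word p q (n + r)); split=> //; [exact: subshift_word|apply: mU => n /wE].
have [e e0 eE] := subshift_recurrent p q_gt0 r m.
exists (fun n => word p q (n + (e%:Z + r))); split; first exact: subshift_word.
  by apply: mU => n nm; rewrite eE // -wE.
(* At this position one translate reads [word] at 0, a marker, and the other at [-e < 0], where
   there is none. *)
rewrite -we => /(congr1 (@^~ (- e%:Z - r))).
rewrite (_ : - e%:Z - r + (e%:Z + r) = 0); last by lia.
rewrite subrK => E; have := word_marker q p_gt0 (- e%:Z).
rewrite -E word_marker // !dist_next_le0; lia.
Qed.

Lemma subshift_shiftE : shift_left @` Z = Z.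
Proof.
apply/seteqP; split=> [_ [w wZ <-]|w wZ]; first exact: subshift_shift.
by exists (shift_right w); [exact: subshift_shift|exact: shift_rightK].
Qed.

Lemma subshift_period_le (D : set {ptws int -> nat}) k : D `<=` Z -> closed D ->
  fund_period shift_left D k -> (k %| p)%N \/ (k %| q)%N.
Proof.
move=> DZ /closed_windowP cD kD; have [k0 [gk _]] := kD.
have sub w a v : D w -> (p <= w a)%N -> Z v -> (forall n, (p <= v n)%N ->
    (q%:Z %| ((v n)%:Z - n) - ((w a)%:Z - a))%Z) -> D v.
  move=> Dw wa vZ vw; apply: cD => m.
  (* Shifts by multiples of [k] stay in [D], and density requires a multiple of [q]. *)
  have kq0 : (0 < k * q)%N by rewrite muln_gt0 k0.
  have [j jE] := subshift_dense p_gt0 q_gt0 m (DZ _ Dw) vZ wa kq0 (dvdn_mull _ (dvdnn q)) vw.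
  exists (fun n => w (n + (k * q)%N%:Z * j)) => //.
  by rewrite PoszM -mulrA; exact: (hyper_iter_shiftE gk).
have [[w [a [Dw wa]]]|nD] := pselect (exists w a, D w /\ (p <= w a)%N); [right|left].
  have shq v s : D v -> D (fun n => v (n + s * q%:Z)).
    move=> Dv; have vZ := DZ _ Dv; have svZ := subshift_shift (s * q%:Z) vZ.
    have [[b vb]|nv] := pselect (exists b, (p <= v b)%N).
      apply: (sub v b) => // n vn.
      have := rpredD (subshift_phase p_gt0 q_gt0 vZ vn vb) (dvdz_mull s (dvdzz q%:Z)).
      by congr (_ %| _)%Z; lia.
    (* A marker-free point satisfies the phase condition vacuously, hence is a limit of shifts of
       [w]. *)
    by apply: (sub w a) => // n vn; case: nv; exists (n + s * q%:Z).
  apply: (fund_period_dvd kD); apply/seteqP; split=> v.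
    rewrite hyper_iter_shift => /(shq _ 1); congr D.
    by apply/funext => n; rewrite mul1r addrK.
  by rewrite hyper_iter_shift => /(shq _ (-1)); rewrite mulN1r.
have Dlt w n : D w -> (w n < p)%N.
  by move=> Dw; rewrite ltnNge; apply/negP => wn; apply: nD; exists w, n.
apply: (fund_period_dvd kD); apply/funext => v; rewrite hyper_iter_shift.
have per w : D w -> forall n, w (n + p%:Z) = w n.
  by move=> Dw; apply: (word_periodic p_gt0 (DZ _ Dw)) => n; exact: Dlt.
rewrite propeqE; split=> Dv.
  rewrite (_ : v = (fun n => v (n - p%:Z))) //.
  by apply/funext => n; rewrite -(per _ Dv n) /= addrK.
rewrite (_ : (fun n => _) = v) //.
by apply/funext => n; rewrite -(per _ Dv (n - p%:Z)) subrK.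
Qed.

(** The set cut out of [Z] by a constraint [Q] of period [k] in the position is fixed by the [k]-th
    shift; the symbol of [w0] at 0 rules out smaller shifts. *)
Lemma subshift_slice (Q : int -> nat -> Prop) k w0 : (0 < k)%N ->
  (forall n v, Q (n + k%:Z) v <-> Q n v) ->
  Z w0 -> (forall n, Q n (w0 n)) ->
  (forall j : nat, (0 < j < k)%N -> ~ Q j (w0 0)) ->
  exists D : set {ptws int -> nat}, [/\ D `<=` Z, hyper_elem D & fund_period shift_left D k].
Proof.
move=> k0 Qk w0Z Q0 Qj.
pose D : set {ptws int -> nat} := [set w | Z w /\ forall n, Q n (w n)].
have DE j w : hyper_iter shift_left j D w <-> Z w /\ forall n, Q (n + j%:Z) (w n).
  rewrite hyper_iter_shift; split=> -[wZ wQ]; split.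
  - have := subshift_shift j%:Z wZ; congr (subshift p q).
    by apply/funext => n; rewrite addrK.
  - by move=> n; have := wQ (n + j%:Z); rewrite addrK.
  - exact: subshift_shift.
  - by move=> n; have := wQ (n - j%:Z); rewrite subrK.
exists D; split; first by move=> w [].
  split; first by exists w0.
  apply/closed_windowP => w wD; split.
    apply/(closed_windowP Z).1 => [|m]; first exact: subshift_closed.
    by have [y [yZ _] wy] := wD m; exists y.
  by move=> n; have [y [_ yQ] ->] := wD (absz n).
split=> //; split.
  apply/seteqP; split=> w.
    by move=> /DE[wZ wQ]; split=> // n; apply/Qk.
  by move=> [wZ wQ]; apply/DE; split=> // n; apply/Qk.
move=> j j0 jk jD; have : hyper_iter shift_left j D w0 by rewrite jD.
by move=> /DE[_ /(_ 0)]; rewrite add0r; apply: Qj; rewrite j0.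
Qed.

Lemma subshift_period_ge k : (0 < k)%N -> (k %| p)%N \/ (k %| q)%N ->
  exists D : set {ptws int -> nat}, [/\ D `<=` Z, hyper_elem D & fund_period shift_left D k].
Proof.
move=> k0 [kp|kq].
  (* Every [k]-th point of the [p]-cycle. *)
  apply: (@subshift_slice (fun n v => (v < p)%N /\ (k%:Z %| v%:Z + n)%Z) k
    (fun n => absz (- n %% p%:Z)%Z) k0).
  - by move=> n v; rewrite addrA rpredDr ?dvdzz.
  - exact: subshift_cycle.
  - move=> n; have m0 : 0 <= (- n %% p%:Z)%Z by rewrite modz_ge0 //; lia.
    have mp : (- n %% p%:Z)%Z < p%:Z by rewrite ltz_mod //; lia.
    split; first by lia.
    rewrite gez0_abs //; apply: (@dvdz_trans p%:Z) => //.
    by rewrite -[X in (_ + X)]opprK -eqz_mod_dvd modz_mod.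
  - move=> j /andP[j0 jk] [_]; rewrite oppr0 mod0z add0r => /(dvdn_leq j0); lia.
(* The phase classes congruent modulo [k] to that of [word], together with the [p]-cycle, where the
   constraint is void. *)
apply: (@subshift_slice (fun n v => (p <= v)%N -> (k%:Z %| v%:Z - p%:Z - n)%Z) k
  (word p q) k0).
- by move=> n v; rewrite opprD addrA rpredDr ?rpredN ?dvdzz.
- by move=> m; exists 0 => n _; rewrite addr0.
- by move=> n /(word_phase p_gt0 q_gt0); apply: dvdz_trans.
- move=> j /andP[j0 jk] h; have := h; rewrite word_marker // => /(_ isT).
  rewrite /word /= mod0z addn0 subrr sub0r dvdzE abszN => /(dvdn_leq j0); lia.
Qed.

End periods.

Theorem theorem7p4 (p q : nat) (hp : (0 < p)%N) (hq : (0 < q)%N) :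
  exists g : cantor_space -> cantor_space,
    continuous g /\ (forall y, exists x, g x = y) /\
    forall m : nat, Per_hyper g m <-> ((0 < m)%N /\ (m %| p \/ m %| q)%N).
Proof.
pose X : pseudoMetricType Rdefinitions.R := {ptws int -> nat}.
have hX : hausdorff_space X.
  by apply: hausdorff_product => _; exact: discrete_hausdorff.
have [h [hc hI hZ]] : exists h : cantor_space -> X,
    [/\ continuous h, injective h & range h = subshift p q].
  apply: cantor_embedding => //.
  - by apply: zero_dimension_prod => _; exact: discrete_zero_dimension.
  - exact: subshift_compact.
  - by exists (word p q) => m; exists 0 => n _; rewrite addr0.
  - exact: subshift_perfect.
have [|g [gc gs gP]] := cantor_conjugate hX hc hI shift_continuous.
  by rewrite hZ subshift_shiftE.
exists g; split=> //; split=> // m; rewrite gP hZ; split.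
  by move=> [D [DZ [_ cD] mD]]; split; [case: mD|exact: subshift_period_le cD mD].
by move=> [m0 mpq]; exact: subshift_period_ge.
Qed.
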